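(* The family $\mathcal{F}_7=\{K_3,P_4,S_3\}$ is $k$-nice for infinitely many positive integers $k$.
   Context: Graphs are finite and simple. $K_3$ is the triangle, $P_4$ is the path on four vertices (three edges), $S_3=K_{1,3}$ is the star with three edges. A copy of a graph means a copy as a subgraph, not necessarily induced. For a family $\mathcal{F}$ of graphs and a positive integer $k$, $R_k(\mathcal{F})$ is the smallest integer $n$ such that every coloring of $E(K_n)$ with $k$ colors (not necessarily proper) yields a monochromatic copy of some $F\in\mathcal{F}$. The family $\mathcal{F}$ is $k$-nice if for every graph $G$ with chromatic number $\chi(G)=R_k(\mathcal{F})$ and every $k$-coloring of $E(G)$ there is a monochromatic copy of some $F\in\mathcal{F}$. *)

(* Defs.v *)
From mathcomp Require Import all_boot.

Set Implicit Arguments.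
Unset Strict Implicit.
Unset Printing Implicit Defensive.

Record sgraph := SGraph {
  vertex :> finType;
  adj : rel vertex;
  adj_sym : symmetric adj;
  adj_irrefl : irreflexive adj }.

Definition proper_coloring (G : sgraph) (T : eqType) (f : G -> T) : bool :=
  [forall x, forall y, adj x y ==> (f x != f y)].

Definition colorable (G : sgraph) (n : nat) : bool :=
  [exists f : {ffun G -> 'I_n}, proper_coloring f].

Fact colorable_ex (G : sgraph) : exists n, colorable G n.
Proof.
exists #|G|; apply/existsP; exists [ffun x => enum_rank x].
apply/forallP=> x; apply/forallP=> y; apply/implyP=> xy.
rewrite !ffunE (inj_eq enum_rank_inj).
by apply: contraTneq xy => ->; rewrite adj_irrefl.
Qed.

Definition chromatic_number (G : sgraph) : nat := ex_minn (colorable_ex G).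

Fact complete_sym n : symmetric [rel i j : 'I_n | i != j].
Proof. by move=> i j /=; rewrite eq_sym. Qed.

Fact complete_irrefl n : irreflexive [rel i j : 'I_n | i != j].
Proof. by move=> i /=; rewrite eqxx. Qed.

Definition complete (n : nat) : sgraph :=
  SGraph (@complete_sym n) (@complete_irrefl n).

Definition path_rel n : rel 'I_n :=
  fun i j => (i.+1 == j :> nat) || (j.+1 == i :> nat).

Fact path_rel_sym n : symmetric (@path_rel n).
Proof. by move=> i j; rewrite /path_rel orbC. Qed.

Fact path_rel_irrefl n : irreflexive (@path_rel n).
Proof. by move=> i; rewrite /path_rel orbb gtn_eqF. Qed.

(* The index is the number of vertices. *)
Definition path_graph (n : nat) : sgraph :=
  SGraph (@path_rel_sym n) (@path_rel_irrefl n).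

Definition star_rel n : rel 'I_n.+1 :=
  fun i j => (i == ord0) (+) (j == ord0).

Fact star_rel_sym n : symmetric (@star_rel n).
Proof. by move=> i j; rewrite /star_rel addbC. Qed.

Fact star_rel_irrefl n : irreflexive (@star_rel n).
Proof. by move=> i; rewrite /star_rel addbb. Qed.

(* The index is the number of edges; the centre is ord0. *)
Definition star_graph (n : nat) : sgraph :=
  SGraph (@star_rel_sym n) (@star_rel_irrefl n).

Definition graph_family := sgraph -> Prop.

(* A k-coloring of E(G) is given by a function on all vertex sets, of which
   only the values at the edges [set x; y] matter; for k > 0 every coloring of
   the edges extends to such a function. *)
Definition edge_coloring (G : sgraph) (k : nat) := {set G} -> 'I_k.

Definition mono_copy (F G : sgraph) k (c : edge_coloring G k) : Prop :=
  exists (f : F -> G) (a : 'I_k), injective f /\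
    forall x y : F, adj x y -> adj (f x) (f y) /\ c [set f x; f y] = a.

Definition arrows (G : sgraph) (k : nat) (FF : graph_family) : Prop :=
  forall c : edge_coloring G k, exists F : sgraph, FF F /\ mono_copy F c.

Definition is_ramsey_number (FF : graph_family) (k n : nat) : Prop :=
  arrows (complete n) k FF /\
  forall m : nat, arrows (complete m) k FF -> n <= m.

(* The existence of the Ramsey number is part of the assertion, so that
   niceness never holds for want of one. *)
Definition nice (FF : graph_family) (k : nat) : Prop :=
  exists n : nat, is_ramsey_number FF k n /\
    forall G : sgraph, chromatic_number G = n -> arrows G k FF.

Definition F7 : graph_family :=
  fun F => F = complete 3 \/ F = path_graph 4 \/ F = star_graph 3.

(* Main.v *)
(* An F7-free color class on A is a union of disjoint paths with at most two
   edges, so its degree sum is at most 4/3 |A|. Hence an F7-free k-colored graph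
   is floor(4k/3)-degenerate, and its chromatic number is at most n when
   4k + 3 = 3n. It remains to k-color K_n without members of F7 for infinitely
   many such pairs: then the Ramsey number is n + 1, and the degeneracy bound is
   niceness. For n = 9, k = 6 a coloring comes from the affine plane over F_3.
   From a coloring of K_n with k colors one of K_{9n} with 9k + 6 colors is
   obtained by blowing up each vertex to nine points: each two-edge star becomes
   a K_{9,18}, which splits into nine star factors by cyclic shifts. *)

Require Import Defs.
From Stdlib Require Import Classical.
From mathcomp Require Import all_boot all_algebra zify.
Import GRing.Theory.

Set Implicit Arguments.
Unset Strict Implicit.
Unset Printing Implicit Defensive.

(** * Upper bound: degree sums and degeneracy *)

(** The path hypothesis admits [w = x], so it excludes triangles too. No components are formed: a
    local inequality is summed over [A], using that neighbours of a vertex of degree 2 have degree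
    at most 1. *)
Lemma sum_degree_le (T : finType) (e : rel T) (A : {set T}) :
    symmetric e ->
    (forall x y z w, e x y -> e y z -> e z w -> x != z -> y != w -> False) ->
    (forall x y z w, uniq [:: y; z; w] -> e x y -> e x z -> e x w -> False) ->
  3 * \sum_(x in A) #|[set y in A | e x y]| <= 4 * #|A|.
Proof.
move=> e_sym no_path no_star; pose d x := #|[set y in A | e x y]|.
have d_le2 x : d x <= 2.
  rewrite leqNgt; apply/negP=> /card_gt2P[y [z [w []]]].
  rewrite !inE => -[/andP[_ xy] /andP[_ xz] /andP[_ xw]] [yz zw wy].
  apply: (no_star x y z w) => //=.
  by rewrite !inE negb_or yz zw eq_sym wy.
have d_le1 x y : x \in A -> y \in A -> e x y -> d x = 2 -> d y <= 1.
  move=> xA yA xy dx; rewrite leqNgt; apply/negP=> dy.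
  have [w] : exists w, w \in [set z in A | e x z] :\ y.
    by apply/card_gt0P; move: dx; rewrite /d (cardsD1 y) inE yA xy add1n => -[->].
  rewrite !inE => /andP[wy /andP[_ xw]].
  have [z] : exists z, z \in [set z in A | e y z] :\ x.
    apply/card_gt0P; rewrite -ltnS; move: dy.
    by rewrite /d (cardsD1 x) inE xA e_sym xy.
  rewrite !inE => /andP[zx /andP[_ yz]].
  by apply: (no_path w x y z); rewrite // 1?e_sym // eq_sym.
(* Summed over A, the second term becomes the sum of the d x ^ 2, so the two
   sides can be compared although 3 * d x <= 4 fails when d x = 2. *)
have local_bound x : x \in A ->
    3 * d x + \sum_(y in A | e x y) d y <= 4 + d x * d x.
  move=> xA.
  have sum_le M : (forall y, y \in A -> e x y -> d y <= M) ->
      \sum_(y in A | e x y) d y <= d x * M.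
    move=> dM; rewrite /d -sum_nat_const.
    rewrite [leqRHS](eq_bigl (fun y => (y \in A) && e x y)).
      by apply: leq_sum => y /andP[]; apply: dM.
    by move=> y; rewrite inE.
  (* For [d x] equal to 1 and 2 the worst cases are 3 + 2 <= 4 + 1 and 6 + 2 <= 4 + 4, both
     tight. *)
  case dx: (d x) (d_le2 x) => [|[|[|]]] // _.
  - by have := sum_le 2 (fun y _ _ => d_le2 y); rewrite dx; lia.
  - by have := sum_le 2 (fun y _ _ => d_le2 y); rewrite dx; lia.
  - have := sum_le 1 (fun y yA xy => d_le1 x y xA yA xy dx); rewrite dx; lia.
have: \sum_(x in A) (3 * d x + \sum_(y in A | e x y) d y) <=
      \sum_(x in A) (4 + d x * d x) by apply: leq_sum.
rewrite big_split [leqRHS]big_split -[X in X + _ <= _]big_distrr /=.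
suff -> : \sum_(x in A) \sum_(y in A | e x y) d y = \sum_(y in A) d y * d y.
  by rewrite leq_add2r sum_nat_const [leqRHS]mulnC.
rewrite (exchange_big_dep (mem A)) /=; last by move=> x y _ /andP[].
apply: eq_bigr => y yA; rewrite sum_nat_const; congr (_ * _).
by apply: eq_card => x; rewrite [LHS]/in_mem /= inE yA e_sym.
Qed.

(** Greedy colouring: a vertex with at most [n] neighbours in [A] is coloured last. *)
Lemma degenerate_colorable (G : sgraph) n :
    (forall A : {set G}, A != set0 ->
      exists2 x, x \in A & #|[set y in A | adj x y]| <= n) ->
  colorable G n.+1.
Proof.
move=> degen.
suff partial m (A : {set G}) : #|A| = m ->
    exists f : {ffun G -> 'I_n.+1}, {in A &, forall x y, adj x y -> f x != f y}.
  have [f fP] := partial _ [set: G] erefl.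
  apply/existsP; exists f; apply/forallP => x; apply/forallP => y.
  by apply/implyP; apply: fP; rewrite inE.
elim: m A => [A /cards0_eq -> | m IHm A Am].
  by exists [ffun=> ord0] => x y; rewrite inE.
have [|x xA dx] := degen A; first by rewrite -card_gt0 Am.
have [|f fP] := IHm (A :\ x); first by move: Am; rewrite (cardsD1 x) xA => -[].
pose B := f @: [set y in A | adj x y].
have [i iB] : exists i, i \notin B.
  apply/existsP; rewrite -negb_forall; apply/negP => /forallP fullB.
  have : #|'I_n.+1| <= #|B| by apply/subset_leq_card/subsetP => i _.
  by rewrite card_ord leqNgt ltnS (leq_trans (leq_imset_card _ _)).
have fi y : y \in A -> adj x y -> i != f y.
  by move=> yA xy; apply: contraNneq iB => ->; rewrite imset_f // inE yA.
exists [ffun y => if y == x then i else f y] => y z yA zA yz; rewrite !ffunE.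
have [yx|yx] := eqVneq y x; have [zx|zx] := eqVneq z x.
- by move: yz; rewrite yx zx adj_irrefl.
- by apply: fi => //; rewrite -yx.
- by rewrite eq_sym; apply: fi => //; rewrite -zx adj_sym.
- by apply: fP; rewrite // !inE ?yx ?zx.
Qed.

(** Summed over the colours, the average degree within [A] is at most 4k/3 < n + 1, so some vertex
    has at most [n] neighbours there. *)
Lemma free_colorable (G : sgraph) k n (c : edge_coloring G k) :
    4 * k < 3 * n.+1 -> ~ (exists F, F7 F /\ mono_copy F c) -> colorable G n.+1.
Proof.
move=> kn free; apply: degenerate_colorable => A A0.
pose e a x y := adj x y && (c [set x; y] == a).
have e_sym a : symmetric (e a) by move=> x y; rewrite /e adj_sym setUC.
have e_neq a x y : e a x y -> x != y.
  by case/andP=> xy _; apply: contraTneq xy => ->; rewrite adj_irrefl.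
have eE a x y : e a x y -> adj x y /\ c [set x; y] = a by case/andP=> ? /eqP.
have no_path a x y z w :
    e a x y -> e a y z -> e a z w -> x != z -> y != w -> False.
  move=> xy yz zw xz yw; apply: free.
  have [xw|xw] := eqVneq x w.
    rewrite -xw in zw; exists (complete 3); split; first by left.
    exists (tnth [tuple x; y; z]), a; split.
      by apply/tuple_uniqP; rewrite /= !inE negb_or xz !(e_neq a).
    move=> [[|[|[|//]]] ?] [[|[|[|//]]] ?] //= _; rewrite !(tnth_nth x) /=;
      by apply: eE; rewrite // e_sym.
  exists (path_graph 4); split; first by right; left.
  exists (tnth [tuple x; y; z; w]), a; split.
    by apply/tuple_uniqP; rewrite /= !inE !negb_or xz xw yw !(e_neq a).
  move=> [[|[|[|[|//]]]] ?] [[|[|[|[|//]]]] ?] //= _; rewrite !(tnth_nth x) /=;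
    by apply: eE; rewrite // e_sym.
have no_star a x y z w :
    uniq [:: y; z; w] -> e a x y -> e a x z -> e a x w -> False.
  move=> yzw xy xz xw; apply: free.
  exists (star_graph 3); split; first by right; right.
  exists (tnth [tuple x; y; z; w]), a; split.
    by apply/tuple_uniqP; rewrite cons_uniq yzw !inE !negb_or !(e_neq a).
  move=> [[|[|[|[|//]]]] ?] [[|[|[|[|//]]]] ?] //= _; rewrite !(tnth_nth x) /=;
    by apply: eE; rewrite // e_sym.
have degE x : #|[set y in A | adj x y]| = \sum_a #|[set y in A | e a x y]|.
  rewrite -sum1_card (partition_big (fun y => c [set x; y]) predT) //=.
  apply: eq_bigr => a _; rewrite -sum1_card; apply: eq_bigl => y.
  by rewrite !inE andbA.
have deg_sum : 3 * \sum_(x in A) #|[set y in A | adj x y]| <= 4 * k * #|A|.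
  rewrite (eq_bigr _ (fun x _ => degE x)) exchange_big big_distrr /=.
  rewrite mulnAC mulnC -[k in k * _]card_ord -sum_nat_const.
  apply: leq_sum => a _; exact: sum_degree_le (e_sym a) (no_path a) (no_star a).
apply/exists_inP; apply: contraTT deg_sum; rewrite negb_exists_in -ltnNge.
move=> /forall_inP deg_gt.
have: n.+1 * #|A| <= \sum_(x in A) #|[set y in A | adj x y]|.
  rewrite mulnC -sum_nat_const; apply: leq_sum => x xA.
  by rewrite ltnNge; apply: deg_gt.
by rewrite -card_gt0 in A0; nia.
Qed.

Lemma complete_colorable m n : colorable (complete m) n -> m <= n.
Proof.
case/existsP=> f /forallP fP.
rewrite -(card_ord m) -[leqRHS]card_ord; apply: (leq_card f) => x y fxy.
by have /forallP/(_ y)/implyP/= := fP x; rewrite fxy eqxx; case: eqP => // _ /(_ isT).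
Qed.

(** * Lower bound: colourings by small stars *)

(* [o u v] says that [u] is the centre of the monochromatic star containing
   [uv]; an isolated edge has an arbitrarily chosen centre. *)
Definition star_coloring (T : eqType) (K : Type) (c : T -> T -> K) (o : rel T) :=
  [/\ forall u v, c u v = c v u,
      forall u v, u != v -> o v u = ~~ o u v,
      forall u v w, uniq [:: u; v; w] -> c u v = c u w -> o u v
    & forall u v w z, uniq [:: u; v; w; z] ->
        c u v = c u w -> c u v = c u z -> False].

(** The middle edge of a monochromatic P_4, or any edge of a triangle, would have both ends as
    centre; the last clause excludes S_3. *)
Lemma star_coloring_free (T K : finType) (c : T -> T -> K) o m :
    star_coloring c o -> 0 < #|K| -> m <= #|T| ->
  ~ arrows (complete m) #|K| F7.
Proof.
case=> c_sym o_anti o_out c_star /card_gt0P[a0 _] mT.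
pose g (i : 'I_m) : T := enum_val (widen_ord mT i).
have g_inj : injective g by move=> i j /enum_val_inj/(congr1 val)/= /val_inj.
(* Any pair spanning [A] gives the same colour, as [c] is symmetric; [a0] is a default for all other
   sets. *)
pose C (A : {set complete m}) : 'I_#|K| :=
  enum_rank (if [pick p : 'I_m * 'I_m | A == [set p.1; p.2]] is Some p
             then c (g p.1) (g p.2) else a0).
have CE i j : C [set i; j] = enum_rank (c (g i) (g j)).
  rewrite /C; case: pickP => [[i' j'] /= /eqP ij | /(_ (i, j))]; last by rewrite eqxx.
  congr enum_rank.
  have := set21 i j; have := set22 i j; rewrite ij !inE.
  have := set21 i' j'; have := set22 i' j'; rewrite -ij !inE.
  by do 4![case/orP=> /eqP ?]; subst.
move=> /(_ C)[F [F7F [f [a [f_inj fP]]]]].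
have out x y z : adj x y -> adj x z -> y != z -> o (g (f x)) (g (f y)).
  move=> xy xz yz; have [_ Cxy] := fP _ _ xy; have [_ Cxz] := fP _ _ xz.
  apply: (o_out _ _ (g (f z))).
    rewrite /= !inE !(inj_eq g_inj) !(inj_eq f_inj) negb_or yz !andbT.
    by apply/andP; split; apply: contraTneq isT => E; move: xy xz;
      rewrite -?E adj_irrefl.
  by apply: enum_rank_inj; rewrite -!CE Cxy.
have no_path (x y z w : F) : adj x y -> adj y z -> adj z w -> x != z -> y != w -> False.
  move=> xy yz zw xz yw; have yz' : g (f y) != g (f z).
    rewrite (inj_eq g_inj) (inj_eq f_inj).
    by apply: contraTneq yz => ->; rewrite adj_irrefl.
  have := out y z x yz; rewrite adj_sym xy eq_sym xz => /(_ isT isT).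
  have := out z y w; rewrite adj_sym yz zw yw => /(_ isT isT isT).
  by rewrite o_anti // => /negP.
case: F7F => [|[|]] FE; subst F.
- exact: (no_path (@Ordinal 3 0 isT) (@Ordinal 3 1 isT) (@Ordinal 3 2 isT)
    (@Ordinal 3 0 isT)).
- exact: (no_path (@Ordinal 4 0 isT) (@Ordinal 4 1 isT) (@Ordinal 4 2 isT)
    (@Ordinal 4 3 isT)).
- pose leaf i lti : star_graph 3 := @Ordinal 4 i lti.
  pose h x := g (f x).
  apply: (c_star (h (leaf 0 isT)) (h (leaf 1 isT)) (h (leaf 2 isT)) (h (leaf 3 isT))).
  - by rewrite /= !inE !(inj_eq g_inj) !(inj_eq f_inj).
  - by apply: enum_rank_inj; rewrite -!CE !(fun x y xy => (fP x y xy).2).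
  - by apply: enum_rank_inj; rewrite -!CE !(fun x y xy => (fP x y xy).2).
Qed.

(** An edge between fibres records the colour of its projection and the shift from centre to leaf,
    so a point over a centre has one leaf per shift in each leaf fibre. All fibres share the colours
    of [c']. *)
Lemma star_coloring_prod (T : eqType) (K : Type) (c : T -> T -> K) o
    (V : zmodType) (L : Type) (c' : V -> V -> L) o' :
    star_coloring c o -> star_coloring c' o' ->
  exists (C : T * V -> T * V -> K * V + L) O, star_coloring C O.
Proof.
case=> c_sym o_anti o_out c_star [c'_sym o'_anti o'_out c'_star].
pose C (p q : T * V) : K * V + L :=
  if p.1 == q.1 then inr (c' p.2 q.2)
  else inl (c p.1 q.1, if o p.1 q.1 then q.2 - p.2 else p.2 - q.2)%R.
pose O (p q : T * V) := if p.1 == q.1 then o' p.2 q.2 else o p.1 q.1.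
(* Equal shifts into the same fibre would force [v = w]. *)
have C_cross u v w : u != v -> u != w -> v != w -> C u v = C u w ->
    u.1 != v.1 -> [/\ u.1 != w.1, v.1 != w.1 & c u.1 v.1 = c u.1 w.1].
  case: u v w => [u a] [v b] [w d] /= _ _ vw; rewrite /C /= => + uv.
  rewrite (negPf uv); case: eqVneq => // uw [cE sE]; split=> //.
  apply: contraNneq vw => vwE; rewrite xpair_eqE vwE eqxx /=.
  move: sE; rewrite -vwE; case: ifP => _; first by move/addIr=> ->.
  by move/addrI/oppr_inj=> ->.
have C_fibre u v w : C u v = C u w -> u.1 = v.1 -> u.1 = w.1 /\ c' u.2 v.2 = c' u.2 w.2.
  by rewrite /C => + uv; rewrite uv eqxx; case: eqVneq => // -> [].
exists C, O; split.
- move=> [u a] [v b]; rewrite /C /= [v == u]eq_sym; case: eqVneq => [_|uv].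
    by rewrite c'_sym.
  by rewrite c_sym (o_anti u v) //; case: (o u v).
- move=> [u a] [v b]; rewrite /O xpair_eqE /= [v == u]eq_sym.
  case: eqVneq => [_|uv] /=; [exact: o'_anti | by move=> _; apply: o_anti].
- move=> u v w; rewrite /= !inE negb_or andbT => /andP[/andP[uv uw] vw] CE.
  rewrite /O; case: eqVneq => [uv1|uv1].
    have [uw1 c'E] := C_fibre _ _ _ CE uv1.
    apply: (o'_out _ _ w.2) => //=; rewrite !inE negb_or andbT.
    case: u v w uv uw vw {CE} uv1 uw1 c'E => [u a] [v b] [w d] /= + + + ? ? _.
    by subst; rewrite !xpair_eqE eqxx /= => -> -> ->.
  have [uw1 vw1 cE] := C_cross _ _ _ uv uw vw CE uv1.
  by apply: (o_out _ _ w.1); rewrite //= !inE negb_or uv1 uw1 vw1.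
- move=> u v w z; rewrite /= !inE !negb_or andbT.
  case/and3P=> /and3P[uv uw uz] /andP[vw vz] wz CE CE'.
  have [uv1|uv1] := eqVneq u.1 v.1.
    have [uw1 c'E] := C_fibre _ _ _ CE uv1.
    have [uz1 c'E'] := C_fibre _ _ _ CE' uv1.
    apply: (c'_star u.2 v.2 w.2 z.2) => //=; rewrite !inE !negb_or andbT.
    move: u v w z uv uw uz vw vz wz uv1 uw1 uz1 {CE CE' c'E c'E'}.
    move=> [u a] [v b] [w d] [z e] /= + + + + + + ? ? ?.
    by subst; rewrite !xpair_eqE !eqxx /= => -> -> -> -> -> ->.
  have [uw1 vw1 cE] := C_cross _ _ _ uv uw vw CE uv1.
  have [uz1 vz1 cE'] := C_cross _ _ _ uv uz vz CE' uv1.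
  have [_ wz1 _] := C_cross _ _ _ uw uz wz (etrans (esym CE) CE') uw1.
  apply: (c_star u.1 v.1 w.1 z.1); rewrite //= !inE !negb_or.
  by rewrite uv1 uw1 uz1 vw1 vz1 wz1.
Qed.

(** * Base colouring and infinitely many parameters *)

(* For each j there are two color classes: stars centred on the line of second
   coordinate j, with leaves in directions (0, 1) and (-1, -1), and stars centred
   on the line of first coordinate j, with leaves in directions (1, 0) and
   (-1, 1). These four directions represent the non-zero vectors up to sign. *)
Definition plane := ('I_3 * 'I_3)%type.

Definition plane_arc (u v : plane) : bool :=
  (v - u \in [:: (0, 1); (-1, -1); (1, 0); (-1, 1)])%R.

Definition plane_arc_color (u v : plane) : 'I_3 + 'I_3 :=
  if (v - u \in [:: (0, 1); (-1, -1)])%R then inl u.2 else inr u.1.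

Definition plane_color (u v : plane) : 'I_3 + 'I_3 :=
  if plane_arc u v then plane_arc_color u v else plane_arc_color v u.

Definition plane_points : seq plane :=
  [seq (inZp i, inZp j) | i <- iota 0 3, j <- iota 0 3].

Lemma mem_plane_points u : u \in plane_points.
Proof. by case: u => [] [[|[|[|//]]] ?] [[|[|[|//]]] ?]. Qed.

(** A finite check, computed on the explicit list [plane_points]. *)
Lemma plane_star_coloring : star_coloring plane_color plane_arc.
Proof.
have points2 (P : plane -> plane -> bool) :
    all (fun u => all (P u) plane_points) plane_points -> forall u v, P u v.
  move=> /allP allP2 u v; apply: (allP (allP2 u _)); exact: mem_plane_points.
have col_sym u v : plane_color u v == plane_color v u.
  by move: u v; apply: points2; vm_compute.
have arc_anti u v : (u != v) ==> (plane_arc v u == ~~ plane_arc u v).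
  by move: u v; apply: points2; vm_compute.
pose same u v w := uniq [:: u; v; w] && (plane_color u v == plane_color u w).
(* An if, not ==>: vm_compute evaluates both arguments of ==>. *)
have local u v : all (fun w => if same u v w then
    plane_arc u v && all (fun z => ~~ (uniq [:: u; v; w; z] && same u v z)) plane_points
    else true) plane_points.
  by move: u v; apply: points2; vm_compute.
have {}local u v w : same u v w ->
    plane_arc u v /\ forall z, uniq [:: u; v; w; z] -> same u v z -> False.
  move=> uvw; have /allP/(_ w (mem_plane_points w)) := local u v.
  rewrite uvw => /andP[uv /allP noz]; split=> // z uvwz uvz.
  by have := noz z (mem_plane_points z); rewrite uvwz uvz.
split.
- by move=> u v; apply/eqP.
- by move=> u v uv; apply/eqP; apply: (implyP (arc_anti u v)).
- by move=> u v w uvw /eqP uvwE; case: (local u v w) => //; rewrite /same uvw.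
- move=> u v w z uvwz /eqP vw /eqP vz.
  have: same u v w.
    by rewrite /same vw andbT; apply: subseq_uniq uvwz; rewrite /= !eqxx.
  case/local => _ /(_ z uvwz); apply; rewrite /same vz andbT.
  by apply: subseq_uniq uvwz; rewrite /= !eqxx; case: ifP; rewrite ?eqxx.
Qed.

(** The product with the plane preserves the identity: 4(9k + 6) + 3 = 9(4k + 3) = 27n. *)
Lemma star_coloring_exists N :
  exists (T K : finType) (c : T -> T -> K) (o : rel T),
    [/\ N <= #|K|, 4 * #|K| + 3 = 3 * #|T| & star_coloring c o].
Proof.
elim: N => [|N [T [K [c [o [NK TK co]]]]]].
  exists plane, ('I_3 + 'I_3)%type, plane_color, plane_arc.
  by split; [| rewrite card_sum card_prod !card_ord | exact: plane_star_coloring].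
have [C [O CO]] := star_coloring_prod co plane_star_coloring.
exists (T * plane)%type, (K * plane + ('I_3 + 'I_3))%type, C, O; split=> //.
  by rewrite !card_sum !card_prod !card_ord; lia.
by rewrite !card_sum !card_prod !card_ord; lia.
Qed.

Theorem theorem1p4 : forall N : nat, exists k : nat, N < k /\ nice F7 k.
Proof.
move=> N; have [T [K [c [o [NK TK co]]]]] := star_coloring_exists N.+1.
have K_gt0 : 0 < #|K| by lia.
(* Since 4k < 3 [#|T|], this gives both the upper bound on the Ramsey number, from the complete
   graph on [#|T|.+1] vertices, and niceness. *)
have arrows_chi (G : sgraph) : ~~ colorable G #|T| -> arrows G #|K| F7.
  move=> notcol col; apply: NNPP => free; move/negP: notcol; apply.
  have T_gt0 : 0 < #|T| by lia.
  by rewrite -(prednK T_gt0); apply: free_colorable free; rewrite prednK //; lia.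
exists #|K|; split=> //; exists #|T|.+1; split; first split.
- by apply: arrows_chi; apply/negP => /complete_colorable; rewrite ltnn.
- by move=> m am; rewrite ltnNge; apply/negP => /(star_coloring_free co K_gt0).
- move=> G chiG; apply: arrows_chi; apply/negP.
  move: chiG; rewrite /chromatic_number; case: ex_minnP => n _ n_min nT /n_min.
  by rewrite nT ltnn.
Qed.
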